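(* Let $B$ be a bi-ideal of a semigroup $S$. If $S$ is left stable, then $B$ is left stable. Likewise, if $S$ is stable, then $B$ is stable.
   Context: For a semigroup $S$, $S^1$ denotes the monoid obtained from $S$ by adjoining a new identity $1$. Green's preorders on $S$ are $a\leq_{\mathcal L}b\Leftrightarrow S^1a\subseteq S^1b$, $a\leq_{\mathcal R}b\Leftrightarrow aS^1\subseteq bS^1$, $a\leq_{\mathcal J}b\Leftrightarrow S^1aS^1\subseteq S^1bS^1$, with induced equivalence relations $\mathcal L,\mathcal R,\mathcal J$. A semigroup $S$ is left stable if $sa\,\mathcal J\,a\Rightarrow sa\,\mathcal L\,a$ for all $a,s\in S$; right stable if $as\,\mathcal J\,a\Rightarrow as\,\mathcal R\,a$ for all $a,s\in S$; stable if it is both left and right stable. A bi-ideal of $S$ is a subset $B$ of $S$ such that $BS^1B\subseteq B$ (in particular $B$ is a subsemigroup, and stability of $B$ refers to $B$ as a semigroup in its own right). *)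

(* Defs.v *)
From HB Require Import structures.
From mathcomp Require Import all_boot.
From mathcomp Require Import boolp classical_sets.

Set Implicit Arguments.
Unset Strict Implicit.
Unset Printing Implicit Defensive.

Local Open Scope classical_set_scope.
Local Open Scope group_scope.

(* Every [semigroupType] carries a choice structure; [gen_choiceMixin] from
   [boolp] provides one on any type, so this is no restriction on semigroups. *)

(* S^1: the identity [None] is new even when S already has an identity. *)
Definition adjoin1 (S : Type) : Type := option S.

Section Adjoin1.
Variable S : semigroupType.

Definition adjoin1_mul (x y : adjoin1 S) : adjoin1 S :=
  match x, y with
  | Some a, Some b => Some (a * b)
  | Some _, None => x
  | None, _ => y
  end.

Lemma adjoin1_mulA : associative adjoin1_mul.
Proof. by move=> [a|] [b|] [c|] //=; rewrite mulgA. Qed.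

Lemma adjoin1_mul1 : left_id None adjoin1_mul.
Proof. by case. Qed.

Lemma adjoin1_mulr1 : right_id None adjoin1_mul.
Proof. by case. Qed.

HB.instance Definition _ := Choice.on (adjoin1 S).
HB.instance Definition _ := isMonoid.Build (adjoin1 S)
  adjoin1_mulA adjoin1_mul1 adjoin1_mulr1.

Definition to_adjoin1 (a : S) : adjoin1 S := Some a.

End Adjoin1.

Definition set_mulg (G : magmaType) (X Y : set G) : set G :=
  [set x * y | x in X & y in Y].

Section Green.
Variable S : semigroupType.
Implicit Types a b : S.

Local Notation S1 := ([set: adjoin1 S]).
Local Notation "X ** Y" := (set_mulg X Y) (at level 40, left associativity).
Local Notation "[1 a ]" := ([set to_adjoin1 a]) (at level 0).

Definition leL a b : Prop := S1 ** [1 a] `<=` S1 ** [1 b].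
Definition leR a b : Prop := [1 a] ** S1 `<=` [1 b] ** S1.
Definition leJ a b : Prop := S1 ** [1 a] ** S1 `<=` S1 ** [1 b] ** S1.

Definition eqL a b : Prop := leL a b /\ leL b a.
Definition eqR a b : Prop := leR a b /\ leR b a.
Definition eqJ a b : Prop := leJ a b /\ leJ b a.

Definition left_stable : Prop := forall a s : S, eqJ (s * a) a -> eqL (s * a) a.
Definition right_stable : Prop := forall a s : S, eqJ (a * s) a -> eqR (a * s) a.
Definition stable : Prop := left_stable /\ right_stable.

Definition biideal (B : set S) : Prop :=
  (@to_adjoin1 S @` B) ** S1 ** (@to_adjoin1 S @` B) `<=` @to_adjoin1 S @` B.

End Green.

Arguments left_stable S : clear implicits.
Arguments right_stable S : clear implicits.
Arguments stable S : clear implicits.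

Lemma biideal_mulg_closed (S : semigroupType) (B : set S) :
  biideal B -> mulg_closed (fun x => x \in B).
Proof.
move=> hB b c /set_mem Bb /set_mem Bc; apply/mem_set.
have [] : (@to_adjoin1 S @` B) (to_adjoin1 b * 1 * to_adjoin1 c).
  apply: hB; exists (to_adjoin1 b * 1).
    by exists (to_adjoin1 b); [exists b|exists 1].
  by exists (to_adjoin1 c); [exists c|].
by move=> d Bd [<-].
Qed.

(* B as a semigroup in its own right, with the multiplication of S; [hB] does
   not occur in the body but is what the semigroup instance relies on. *)
Definition biideal_type (S : semigroupType) (B : set S) (hB : biideal B) : Type :=
  {x : S | x \in B}.

Section BiidealSemigroup.
Variables (S : semigroupType) (B : set S) (hB : biideal B).

HB.instance Definition _ := SubChoice.on (biideal_type hB).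
HB.instance Definition _ :=
  SubChoice_isSubSemigroup.Build S (fun x => x \in B) (biideal_type hB)
    (biideal_mulg_closed hB).

End BiidealSemigroup.

(* Main.v *)
(** Suppose [a = x s a y] with [x, y] in [B^1], and put [u = x s], an element
    of [B].  Then [a = u^3 a y^3], so [u^3 a] is J-related to [a] in [S], and left
    stability of [S] gives [a = t u^3 a] with [t] in [S^1].  Hence
    [a = u a y = u t u^3 a y = u t u^2 a = (u t u x) (s a)], and the bi-ideal
    property puts [u t u x] in [B].  Right stability is dual. *)
Require Import Defs.
From mathcomp Require Import all_boot.
From mathcomp Require Import boolp classical_sets.

Set Implicit Arguments.
Unset Strict Implicit.
Unset Printing Implicit Defensive.

Local Open Scope classical_set_scope.
Local Open Scope group_scope.

Section GreenDivisibility.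
Variable S : semigroupType.
Implicit Types a b : S.

Lemma to_adjoin1M a b : to_adjoin1 (a * b) = to_adjoin1 a * to_adjoin1 b.
Proof. by []. Qed.

Lemma leLP a b : leL a b <-> exists t, to_adjoin1 a = t * to_adjoin1 b.
Proof.
split=> [ab|[t at_b] _ [z _ [_ -> <-]]].
  have [|t _ [_ -> <-]] := ab (to_adjoin1 a); last by exists t.
  by exists 1 => //; exists (to_adjoin1 a); rewrite ?mul1g.
by exists (z * t) => //; exists (to_adjoin1 b); rewrite // at_b mulgA.
Qed.

Lemma leRP a b : leR a b <-> exists t, to_adjoin1 a = to_adjoin1 b * t.
Proof.
split=> [ab|[t a_bt] _ [_ -> [z _ <-]]].
  have [|_ -> [t _ <-]] := ab (to_adjoin1 a); last by exists t.
  by exists (to_adjoin1 a) => //; exists 1; rewrite ?mulg1.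
by exists (to_adjoin1 b) => //; exists (t * z); rewrite // a_bt mulgA.
Qed.

Lemma leJP a b :
  leJ a b <-> exists x y, to_adjoin1 a = x * to_adjoin1 b * y.
Proof.
split=> [ab|[x [y a_xby]] _ [_ [z _ [_ -> <-]] [w _ <-]]].
  have [|_ [x _ [_ -> <-]] [y _ <-]] := ab (to_adjoin1 a); last by exists x, y.
  exists (to_adjoin1 a); last by exists 1; rewrite ?mulg1.
  by exists 1 => //; exists (to_adjoin1 a); rewrite ?mul1g.
exists (z * x * to_adjoin1 b).
  by exists (z * x) => //; exists (to_adjoin1 b).
by exists (y * w); rewrite // a_xby !mulgA.
Qed.

(** [s * a] is always J-below [a], so the factorisation of [a] through [s * a] already gives
    J-equivalence. *)
Lemma left_stable_divides a s x y : left_stable S ->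
    to_adjoin1 a = x * to_adjoin1 (s * a) * y ->
  exists t, to_adjoin1 a = t * to_adjoin1 (s * a).
Proof.
move=> stS a_xsay; apply/leLP; apply: (proj2 (stS _ _ _)); split; apply/leJP.
  by exists (to_adjoin1 s), 1; rewrite mulg1 to_adjoin1M.
by exists x, y.
Qed.

Lemma right_stable_divides a s x y : right_stable S ->
    to_adjoin1 a = x * to_adjoin1 (a * s) * y ->
  exists t, to_adjoin1 a = to_adjoin1 (a * s) * t.
Proof.
move=> stS a_xasy; apply/leRP; apply: (proj2 (stS _ _ _)); split; apply/leJP.
  by exists 1, (to_adjoin1 s); rewrite mul1g to_adjoin1M.
by exists x, y.
Qed.

End GreenDivisibility.

Section BiidealStability.
Variables (S : semigroupType) (B : set S) (hB : biideal B).
Local Notation T := (biideal_type hB).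
Implicit Types (a b c s : T) (x y : adjoin1 T).

(** Both adjoined identities are new, so this is an injective monoid morphism from [T^1] to
    [S^1]. *)
Definition biideal_incl x : adjoin1 S := omap val x.
Local Notation "\i x" := (biideal_incl x) (at level 9, x at level 9).

Lemma biideal_inclM x y : \i (x * y) = \i x * \i y.
Proof. by case: x y => [a|] [b|]. Qed.

Lemma biideal_incl_inj : injective biideal_incl.
Proof. by apply: inj_omap; exact: val_inj. Qed.

Lemma biideal_sandwich b c (t : adjoin1 S) :
  exists d, \i (to_adjoin1 b) * t * \i (to_adjoin1 c) = \i (to_adjoin1 d).
Proof.
have memB d : (@to_adjoin1 S @` B) (\i (to_adjoin1 d)).
  by exists (val d) => //; exact/set_mem/(valP d).
have [|d /mem_set Bd dE] := @hB (\i (to_adjoin1 b) * t * \i (to_adjoin1 c)).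
  exists (\i (to_adjoin1 b) * t).
    by exists (\i (to_adjoin1 b)) => //; exists t.
  by exists (\i (to_adjoin1 c)).
by exists (Sub d Bd); rewrite -dE.
Qed.

(** Guards against [x = 1]: one factor in [B] keeps the product in [B], as the ends of a sandwich
    must be. *)
Lemma adjoin1_mull_proper x s : exists u, to_adjoin1 u = x * to_adjoin1 s.
Proof. by case: x => [x|]; [exists (x * s)|exists s]. Qed.

Lemma adjoin1_mulr_proper x s : exists u, to_adjoin1 u = to_adjoin1 s * x.
Proof. by case: x => [x|]; [exists (s * x)|exists s]. Qed.

Lemma biideal_left_stable : left_stable S -> left_stable T.
Proof.
move=> stS a s [saJa /leJP[x [y a_xsay]]]; split.
  by apply/leLP; exists (to_adjoin1 s).
have [u uE] := adjoin1_mull_proper x s.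
pose U := \i (to_adjoin1 u); pose A := \i (to_adjoin1 a).
have UE : U = \i x * \i (to_adjoin1 s) by rewrite /U uE biideal_inclM.
have A_UAY : A = U * A * \i y.
  by rewrite /A {1}a_xsay to_adjoin1M UE !biideal_inclM !mulgA.
(* Of the three factors [U], one absorbs [\i y] via [A = U * A * \i y], one closes the sandwich
   around [t], and one is split as [x s]. *)
have [t At] : exists t, A = t * (U * U * U * A).
  apply: (@left_stable_divides S (val a) (val u * val u * val u) 1
            (\i y * \i y * \i y)) => //.
  rewrite mul1g; change (A = U * U * U * A * (\i y * \i y * \i y)).
  by rewrite {1}A_UAY {1}A_UAY {1}A_UAY !mulgA.
have [v vE] : exists v, to_adjoin1 v = to_adjoin1 u * x
  by exact: adjoin1_mulr_proper.
have [d dE] := biideal_sandwich u v t.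
(* Here [d = u t u x]. The equation is checked in [S^1], since [t] need not come from [T^1]. *)
apply/leLP; exists (to_adjoin1 d); apply: biideal_incl_inj.
rewrite to_adjoin1M !biideal_inclM -dE vE biideal_inclM.
transitivity (U * t * U * U * A).
  (* Both sides become [U t U^3 A y]. *)
  by rewrite -/A {1}A_UAY {1}At {2}A_UAY !mulgA.
by rewrite {3}UE !mulgA.
Qed.

(** Now [a = x a s y] and [u = s y], so [a = x^3 a u^3]. Right stability gives [a = a u^3 t], whence
    [a = x a u = x a u^3 t u = a u^2 t u = (a s) (y u t u)]. *)
Lemma biideal_right_stable : right_stable S -> right_stable T.
Proof.
move=> stS a s [asJa /leJP[x [y a_xasy]]]; split.
  by apply/leRP; exists (to_adjoin1 s).
have [u uE] := adjoin1_mulr_proper y s.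
pose U := \i (to_adjoin1 u); pose A := \i (to_adjoin1 a).
have UE : U = \i (to_adjoin1 s) * \i y by rewrite /U uE biideal_inclM.
have A_XAU : A = \i x * A * U.
  by rewrite /A {1}a_xasy to_adjoin1M UE !biideal_inclM !mulgA.
have [t At] : exists t, A = A * (U * U * U) * t.
  apply: (@right_stable_divides S (val a) (val u * val u * val u)
            (\i x * \i x * \i x) 1) => //.
  rewrite mulg1; change (A = \i x * \i x * \i x * (A * (U * U * U))).
  by rewrite {1}A_XAU {1}A_XAU {1}A_XAU !mulgA.
have [v vE] : exists v, to_adjoin1 v = y * to_adjoin1 u
  by exact: adjoin1_mull_proper.
(* [d = y u t u], with left end [v = y u] in [B] even if [y = 1]. *)
have [d dE] := biideal_sandwich v u t.
apply/leRP; exists (to_adjoin1 d); apply: biideal_incl_inj.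
rewrite to_adjoin1M !biideal_inclM -dE vE biideal_inclM.
transitivity (A * U * U * t * U).
  by rewrite -/A {1}A_XAU {1}At {2}A_XAU !mulgA.
by rewrite {1}UE !mulgA.
Qed.

End BiidealStability.

Theorem theorem5p7 (S : semigroupType) (B : set S) (hB : biideal B) :
  (left_stable S -> left_stable (biideal_type hB)) /\
  (stable S -> stable (biideal_type hB)).
Proof.
split=> [|[lS rS]]; first exact: biideal_left_stable.
by split; [exact: biideal_left_stable|exact: biideal_right_stable].
Qed.
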